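(* Let $\mathcal{S}$ be the class of simple combinatorial auctions defined in the context, in the known-budgets setting, where the payment rule is allowed to depend on the players' budgets. For every auction in $\mathcal{S}$ with $m$ items, the pure liquid price of anarchy of the auction, over games in which all players have (monotone) subadditive valuation functions, is at least $\frac{4}{3}-\frac{2}{3m}$, even when the budgets are known.
   Context: Setting: $m$ items are allocated to $n$ players. Player $i$ has a private valuation function $v_i:2^{[m]}\to\mathbb{R}_{\ge 0}$ and a budget $c_i\in\mathbb{R}_{\ge 0}$. A valuation $v_i$ is monotone if $S\subseteq T$ implies $v_i(S)\le v_i(T)$, and subadditive if $v_i(S\cup T)\le v_i(S)+v_i(T)$ for all $S,T\subseteq[m]$. All valuations are assumed monotone and subadditive. Class $\mathcal{S}$: each player $i$ submits bids $\mathbf{b}_i=(b_{ij})_{j\in[m]}$, $b_{ij}\ge 0$; $\mathbf{b}=(\mathbf{b}_i)_{i\in[n]}$ and $\mathbf{b}_{[j]}=(b_{ij})_{i\in[n]}$. An auction in $\mathcal{S}$ allocates each item $j$ independently to a player $\pi(j)$ with the highest bid for it ($b_{\pi(j),j}\ge b_{ij}$ for all $i$; items for which several players have the highest bid are given arbitrarily to one of these players), and charges $\pi(j)$ a payment $p_j(\mathbf{b}_{[j]})\in[0,b_{\pi(j),j}]$, where $p_j$ is non-decreasing and continuous in every bid. Known budgets: the budgets $(c_1,\dots,c_n)$ are common knowledge and the auction may take them into account when defining the payments $p_j$ (but it does not know the valuations). $\mathbf{X}(\mathbf{b})=(X_1,\dots,X_n)$ denotes the resulting allocation, a partition of $[m]$.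 Utility: $u_i(\mathbf{b})=v_i(X_i)-\sum_{j\in X_i}p_j(\mathbf{b}_{[j]})$ if player $i$'s total payment does not exceed $c_i$, and $-\infty$ otherwise. A bid matrix $\mathbf{b}$ is a pure Nash equilibrium if $u_i(\mathbf{b})\ge u_i(\mathbf{y},\mathbf{b}_{-i})$ for every player $i$ and every bid vector $\mathbf{y}$, where $(\mathbf{y},\mathbf{b}_{-i})$ is $\mathbf{b}$ with $\mathbf{b}_i$ replaced by $\mathbf{y}$. $\mathrm{EQ}(\mathcal{G})$ is the set of equilibria of the game $\mathcal{G}$. Conservative behavior (standing assumption): the sum of bids a player submits for a bundle of items exceeds neither her value for this bundle nor her budget, that is, $\sum_{j\in X_i}b_{ij}\le\min\{v_i(X_i),c_i\}$. Liquid welfare: for an allocation $\mathbf{X}$ (a partition of $[m]$ among the players), $\mathrm{LW}(\mathbf{X})=\sum_{i\in[n]}\min\{v_i(X_i),c_i\}$. The pure liquid price of anarchy of an auction is $\mathrm{LPoA}=\sup_{\mathcal{G}}\frac{\max_{\mathbf{Y}}\mathrm{LW}(\mathbf{Y})}{\min_{\mathbf{b}\in\mathrm{EQ}(\mathcal{G})}\mathrm{LW}(\mathbf{X}(\mathbf{b}))}$, the supremum being over all games induced by the auction. *)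

(* Defs.v *)
From mathcomp Require Import all_boot all_order all_algebra.
From mathcomp Require Import all_classical all_reals all_analysis.

Set Implicit Arguments.
Unset Strict Implicit.
Unset Printing Implicit Defensive.

Import Order.TTheory GRing.Theory Num.Theory.
Import numFieldNormedType.Exports.

Local Open Scope classical_set_scope.
Local Open Scope ring_scope.

(* The players are 'I_n and the items 'I_m. *)

Definition replace (n : nat) (T : Type) (b : 'I_n -> T) (i : 'I_n) (y : T) :
    'I_n -> T :=
  fun k => if k == i then y else b k.

Definition nonneg (R : realType) (k : nat) (f : 'I_k -> R) : Prop :=
  forall i, 0 <= f i.

(* An auction of the class S with known budgets. The first argument of
   [winner] and [payment] is the vector of budgets, the last one is the vector
   of the bids of all players for the item under consideration. The field
   [winner] is the player pi(j), ties being broken by an arbitrary rule that is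
   part of the auction. Nothing is required outside nonnegative budgets and
   bids. *)
Record simple_auction (R : realType) (n m : nat) := SimpleAuction {
  winner : ('I_n -> R) -> 'I_m -> ('I_n -> R) -> 'I_n ;
  payment : ('I_n -> R) -> 'I_m -> ('I_n -> R) -> R ;
  winner_max : forall c j b, nonneg c -> nonneg b ->
    forall i, b i <= b (winner c j b) ;
  payment_bounds : forall c j b, nonneg c -> nonneg b ->
    0 <= payment c j b <= b (winner c j b) ;
  payment_nondecreasing : forall c j b i, nonneg c -> nonneg b ->
    forall x y, 0 <= x -> x <= y ->
    payment c j (replace b i x) <= payment c j (replace b i y) ;
  payment_continuous : forall c j b i, nonneg c -> nonneg b ->
    {within [set x | 0 <= x],
      continuous (fun x : R => payment c j (replace b i x))}
}.

Definition monotone (R : realType) (m : nat) (v : {set 'I_m} -> R) : Prop :=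
  forall S T : {set 'I_m}, S \subset T -> v S <= v T.

Definition subadditive (R : realType) (m : nat) (v : {set 'I_m} -> R) : Prop :=
  forall S T : {set 'I_m}, v (S :|: T) <= v S + v T.

(* The private data that, together with an auction, determine a game. *)
Record instance (R : realType) (n m : nat) := Instance {
  valuation : 'I_n -> {set 'I_m} -> R ;
  budget : 'I_n -> R ;
  valuation_ge0 : forall i S, 0 <= valuation i S ;
  valuation_monotone : forall i, monotone (valuation i) ;
  valuation_subadditive : forall i, subadditive (valuation i) ;
  budget_ge0 : nonneg budget
}.

(* An allocation, i.e. a partition (X_1, ..., X_n) of the items with possibly
   empty parts, is encoded as the map sending each item to its owner. *)
Definition bundle (n m : nat) (X : {ffun 'I_m -> 'I_n}) (i : 'I_n) :
    {set 'I_m} :=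
  [set j | X j == i]%SET.

Definition liquid_welfare (R : realType) (n m : nat) (G : instance R n m)
    (X : {ffun 'I_m -> 'I_n}) : R :=
  \sum_(i < n) Num.min (valuation G i (bundle X i)) (budget G i).

Section Game.
Variables (R : realType) (n m : nat).
Variables (A : simple_auction R n m) (G : instance R n m).

(* [b i j] is the bid of player i for item j. *)
Implicit Types (b : 'I_n -> 'I_m -> R) (i : 'I_n).

Definition allocation b : {ffun 'I_m -> 'I_n} :=
  [ffun j => winner A (budget G) j (fun i => b i j)].

Definition won b i : {set 'I_m} := bundle (allocation b) i.

Definition total_payment b i : R :=
  \sum_(j in won b i) payment A (budget G) j (fun k => b k j).

Definition utility b i : \bar R :=
  if total_payment b i <= budget G i
  then (valuation G i (won b i) - total_payment b i)%:E
  else -oo%E.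

Definition conservative b i : Prop :=
  \sum_(j in won b i) b i j
    <= Num.min (valuation G i (won b i)) (budget G i).

(* Conservative behavior is a restriction on how players may bid: it bounds the
   bids actually submitted at equilibrium and also those to which a player may
   deviate. *)
Definition pure_nash b : Prop :=
  [/\ forall i, nonneg (b i),
      forall i, conservative b i &
      forall i (y : 'I_m -> R), nonneg y -> conservative (replace b i y) i ->
        (utility (replace b i y) i <= utility b i)%E].

Definition optimal_liquid_welfare : R :=
  \big[Num.max/0]_(Y : {ffun 'I_m -> 'I_n}) liquid_welfare G Y.

(* The infimum is a minimum if there is an equilibrium, as there are finitely
   many allocations, and is +oo otherwise. *)
Definition worst_equilibrium_welfare : \bar R :=
  ereal_inf [set (liquid_welfare G (allocation b))%:E | b in pure_nash].

(* In \bar R, x / 0 = +oo for x > 0, while 0 / 0 = 0 and x / +oo = 0: games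
   without equilibrium or without welfare do not contribute to the supremum. *)
Definition liquid_ratio : \bar R :=
  ((optimal_liquid_welfare)%:E / worst_equilibrium_welfare)%E.

End Game.

Definition LPoA (R : realType) (n m : nat) (A : simple_auction R n m) :
    \bar R :=
  ereal_sup [set liquid_ratio A G | G in [set: instance R n m]].

(* Main.v *)
(* Give two players the budget m, and all others the budget 0, and let these
   two bid 1 on every item. The auction breaks these ties knowing the budgets
   but not the valuations, so the valuations can be chosen once its allocation
   is known. Let a be the one of the two who wins at least half of the items,
   say a set S of k items, and let b be the other one. Player a only wants
   items of S, and a single one already gives her the value m, her budget; each
   further one adds 1, which is at least its price, so that she keeps all of S.
   Player b has value 1 per item, so that conservativeness forbids her to
   outbid a. This is an equilibrium of liquid welfare m + (m - k) <= 3m/2,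
   whereas giving one item of S to a and the rest to b achieves m + (m - 1). *)

Require Import Defs.
From mathcomp Require Import all_boot all_order all_algebra.
From mathcomp Require Import all_classical all_reals all_analysis.
From mathcomp Require Import zify ring lra.

Import Order.TTheory GRing.Theory Num.Theory.
Import numFieldNormedType.Exports.

Local Open Scope ring_scope.

(** * Utilities, payments and the liquid ratio in an arbitrary game *)

Lemma replace_id (n : nat) (T : Type) (b : 'I_n -> T) (i : 'I_n) :
  replace b i (b i) = b.
Proof. by apply/funext => k; rewrite /replace; case: eqP => [->|]. Qed.

Lemma replace_column (n m : nat) (T : Type) (b : 'I_n -> 'I_m -> T)
    (i : 'I_n) (y : 'I_m -> T) (j : 'I_m) :
  (fun k => replace b i y k j) = replace (fun k => b k j) i (y j).
Proof. by apply/funext => k; rewrite /replace; case: eqP. Qed.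

Section Auction.
Context {R : realType} {n m : nat}.
Variables (A : simple_auction R n m) (G : instance R n m).
Implicit Types (b : 'I_n -> 'I_m -> R) (i : 'I_n) (y : 'I_m -> R).

Lemma mem_won b i j :
  (j \in won A G b i) = (winner A (budget G) j (fun k => b k j) == i).
Proof. by rewrite inE ffunE. Qed.

Lemma nonneg_replace b i y :
  (forall k, nonneg (b k)) -> nonneg y -> forall k, nonneg (replace b i y k).
Proof. by move=> b0 y0 k; rewrite /replace; case: eqP. Qed.

Lemma nonneg_column b j :
  (forall k, nonneg (b k)) -> nonneg (fun k => b k j).
Proof. by move=> b0 k; apply: b0. Qed.

Lemma won_max b i j : (forall k, nonneg (b k)) ->
  j \in won A G b i -> forall k, b k j <= b i j.
Proof.
move=> b0; rewrite mem_won => /eqP <- k.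
by apply: (winner_max A j (budget_ge0 G) (nonneg_column _ j b0)).
Qed.

Lemma payment_ge0 b j : (forall k, nonneg (b k)) ->
  0 <= payment A (budget G) j (fun k => b k j).
Proof.
move=> b0.
by have /andP[] := payment_bounds A j (budget_ge0 G) (nonneg_column _ j b0).
Qed.

Lemma payment_le_bid b i j : (forall k, nonneg (b k)) ->
  j \in won A G b i -> payment A (budget G) j (fun k => b k j) <= b i j.
Proof.
move=> b0; rewrite mem_won => /eqP wi.
have /andP[_] := payment_bounds A j (budget_ge0 G) (nonneg_column _ j b0).
by rewrite wi.
Qed.

Lemma total_payment_ge0 b i : (forall k, nonneg (b k)) ->
  0 <= total_payment A G b i.
Proof. by move=> b0; apply: sumr_ge0 => j _; apply: payment_ge0. Qed.

(** Payments are at most the winning bids, whose sum conservativeness keeps within the budget, so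
    the [-oo] branch is excluded. *)
Lemma utility_within_budget b i : (forall k, nonneg (b k)) ->
  conservative A G b i ->
  utility A G b i = (valuation G i (won A G b i) - total_payment A G b i)%:E.
Proof.
move=> b0; rewrite /conservative le_min => /andP[_ le_c].
rewrite /utility ifT //; apply: le_trans le_c.
by apply: ler_sum => j; apply: payment_le_bid.
Qed.

Lemma utility_le b i (u : R) :
  valuation G i (won A G b i) - total_payment A G b i <= u ->
  (utility A G b i <= u%:E)%E.
Proof.
by move=> le_u; rewrite /utility; case: ifP => _; rewrite ?lee_fin ?leNye.
Qed.

Lemma liquid_ratio_ge b (X : {ffun 'I_m -> 'I_n}) :
  pure_nash A G b -> 0 < liquid_welfare G X ->
  0 < liquid_welfare G (allocation A G b) ->
  ((liquid_welfare G X / liquid_welfare G (allocation A G b))%:E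
     <= liquid_ratio A G)%E.
Proof.
move=> nash X0 eq0; set L := liquid_welfare G X in X0 *.
set E := liquid_welfare G _ in eq0 *.
have LW_ge0 Y : 0 <= liquid_welfare G Y.
  by apply: sumr_ge0 => i _; rewrite le_min valuation_ge0 budget_ge0.
have W0 : (0 <= worst_equilibrium_welfare A G)%E.
  by apply: le_ereal_inf_tmp => _ [b' _ <-]; rewrite lee_fin.
have WE : (worst_equilibrium_welfare A G <= E%:E)%E.
  by apply: ereal_inf_lbound; exists b.
rewrite EFinM /liquid_ratio.
(* The inverse in [\bar R] agrees with the real one only away from 0, hence the hypothesis
   [0 < E]. *)
have -> : (E^-1)%:E = (E%:E)^-1%E by rewrite inver gt_eqF.
apply: lee_pmul; rewrite ?lee_fin ?(ltW X0) ?inve_ge0 ?lee_fin ?(ltW eq0) //.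
  by rewrite /optimal_liquid_welfare (bigD1 X) //= le_max lexx.
by rewrite lee_pV2 // inE lee_fin ltW.
Qed.

End Auction.

(** * The valuation of the player who keeps [S] *)

Lemma card_items (m : nat) (T : {set 'I_m}) : (#|T| <= m)%N.
Proof. by rewrite -[X in (_ <= X)%N]card_ord max_card. Qed.

(** The first item of [S] is worth [m], each further one 1; hence the offset [m.-1]. *)
Definition first_item_value {m : nat} (S T : {set 'I_m}) : nat :=
  if T :&: S == finset.set0 then 0%N else (m.-1 + #|T :&: S|)%N.

Lemma first_item_value_monotone (m : nat) (S T U : {set 'I_m}) :
  T \subset U -> (first_item_value S T <= first_item_value S U)%N.
Proof.
move=> TU; rewrite /first_item_value; case: ifPn => // T0.
have sub : T :&: S \subset U :&: S by rewrite finset.setSI.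
have := subset_leq_card sub; move: T0; rewrite -!cards_eq0.
by do 2!case: eqP; lia.
Qed.

(** Cardinality is subadditive, and the offset [m.-1] counts once on the left but at least once on
    the right as soon as the left side is nonzero. *)
Lemma first_item_value_subadditive (m : nat) (S T U : {set 'I_m}) :
  (first_item_value S (T :|: U)
    <= first_item_value S T + first_item_value S U)%N.
Proof.
rewrite /first_item_value finset.setIUl.
have := cardsU (T :&: S) (U :&: S).
rewrite -!cards_eq0.
by repeat case: eqP; lia.
Qed.

(** * The game with two tied bidders *)

Section TiedGame.
Variables (R : realType) (n m : nat) (a b : 'I_n) (S : {set 'I_m}).

(** The two active players are fixed as 0 and 1, independently of the roles [a] and [b], which are
    assigned only after the ties are broken. *)
Definition tied_budget (i : 'I_n) : R := if (i < 2)%N then m%:R else 0.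

Definition tied_bid (i : 'I_n) (_ : 'I_m) : R := (i < 2)%:R.

Definition tied_valuation (i : 'I_n) (T : {set 'I_m}) : R :=
  (if i == a then first_item_value S T else if i == b then #|T| else 0%N)%:R.

Lemma tied_valuation_monotone i : Defs.monotone (tied_valuation i).
Proof.
move=> T U TU; rewrite ler_nat; case: ifP => _.
  exact: first_item_value_monotone.
by case: ifP => _ //; apply: subset_leq_card.
Qed.

Lemma tied_valuation_subadditive i : Defs.subadditive (tied_valuation i).
Proof.
move=> T U; rewrite -natrD ler_nat; case: ifP => _.
  exact: first_item_value_subadditive.
by case: ifP => _ //; rewrite cardsU leq_subr.
Qed.

Lemma tied_budget_ge0 : nonneg tied_budget.
Proof. by move=> i; rewrite /tied_budget; case: ifP. Qed.

Lemma tied_bid_ge0 i : nonneg (tied_bid i).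
Proof. by move=> j. Qed.

Definition tied_game : instance R n m :=
  Instance (fun i T => ler0n R _) tied_valuation_monotone
    tied_valuation_subadditive tied_budget_ge0.

End TiedGame.

(** * The tied bids form a pure Nash equilibrium *)

Section TiedEquilibrium.
Context {R : realType} {n m : nat}.
Variables (A : simple_auction R n m) (a b : 'I_n).
Hypotheses (ab : a != b) (a2 : (a < 2)%N) (b2 : (b < 2)%N).

(** Stated without any game, since the valuations of [G] are defined from it through [S]; it is
    convertible to the allocation of [G] at [bid]. *)
Definition tied_allocation : {ffun 'I_m -> 'I_n} :=
  [ffun j => winner A (tied_budget R n m) j (fun i => tied_bid R n m i j)].

Let S := bundle tied_allocation a.
Let G := tied_game R n m a b S.
Let bid := tied_bid R n m.
Let pay j := payment A (budget G) j (fun k => bid k j).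

Lemma small_player (i : 'I_n) : (i < 2)%N -> i = a \/ i = b.
Proof.
move=> i2; move: ab; rewrite -val_eqE /= => ab'.
have [] : (i = a :> nat) \/ (i = b :> nat) by lia.
  by move=> /val_inj; left.
by move=> /val_inj; right.
Qed.

Lemma bid_ge0 i : nonneg (bid i). Proof. exact: tied_bid_ge0. Qed.
Lemma tied_bid_a j : bid a j = 1. Proof. by rewrite /bid /tied_bid a2. Qed.
Lemma tied_bid_b j : bid b j = 1. Proof. by rewrite /bid /tied_bid b2. Qed.

Lemma won_a : won A G bid a = S. Proof. by []. Qed.

(** Every winner bids at least the 1 offered by [a], which rules out the players bidding 0. *)
Lemma won_b : won A G bid b = ~: S.
Proof.
apply/setP => j; rewrite finset.in_setC -won_a !mem_won.
set w := winner _ _ _ _.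
have w2 : (w < 2)%N.
  have := winner_max A j (budget_ge0 G) (nonneg_column _ j bid_ge0) a.
  by rewrite /= -/bid -/w tied_bid_a /bid /tied_bid; case: ltnP; rewrite ?ler10.
by case: (small_player _ w2) => ->; rewrite eqxx ?[b == a]eq_sym (negbTE ab).
Qed.

Lemma won_other i : i != a -> i != b -> won A G bid i = finset.set0.
Proof.
move=> ia ib; apply/setP => j; rewrite finset.in_set0; apply/negbTE/negP => ji.
have : (j \in won A G bid a) || (j \in won A G bid b).
  by rewrite won_b won_a finset.in_setC orbN.
move: ji; rewrite !mem_won => /eqP ->.
by rewrite (negbTE ia) (negbTE ib).
Qed.

Lemma pay_le1 j : pay j <= 1.
Proof.
have bid0 := bid_ge0.
have [jS|jS] := boolP (j \in S).
  by rewrite -(tied_bid_a j); apply: payment_le_bid => //; rewrite won_a.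
rewrite -(tied_bid_b j); apply: payment_le_bid => //.
by rewrite won_b finset.in_setC.
Qed.

Lemma sum_pay_le (T : {set 'I_m}) : \sum_(j in T) pay j <= #|T|%:R.
Proof. by rewrite -sumr_const; apply: ler_sum => j _; apply: pay_le1. Qed.

Lemma valuation_a T : valuation G a T = (first_item_value S T)%:R.
Proof. by rewrite /= /tied_valuation eqxx. Qed.

Lemma valuation_b T : valuation G b T = #|T|%:R.
Proof. by rewrite /= /tied_valuation [b == a]eq_sym (negbTE ab) eqxx. Qed.

Lemma valuation_other i T : i != a -> i != b -> valuation G i T = 0.
Proof. by move=> ia ib; rewrite /= /tied_valuation (negbTE ia) (negbTE ib). Qed.

Lemma budget_a : budget G a = m%:R. Proof. by rewrite /= /tied_budget a2. Qed.
Lemma budget_b : budget G b = m%:R. Proof. by rewrite /= /tied_budget b2. Qed.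

Hypothesis S0 : (0 < #|S|)%N.

Lemma first_item_value_self : first_item_value S S = (m.-1 + #|S|)%N.
Proof. by rewrite /first_item_value finset.setIid -cards_eq0 eqn0Ngt S0. Qed.

Lemma tied_conservative i : conservative A G bid i.
Proof.
rewrite /conservative.
have [->|ia] := eqVneq i a.
  under eq_bigr do rewrite tied_bid_a.
  rewrite sumr_const won_a valuation_a budget_a first_item_value_self.
  by rewrite le_min !ler_nat leq_addl card_items.
have [->|ib] := eqVneq i b.
  under eq_bigr do rewrite tied_bid_b.
  by rewrite sumr_const valuation_b budget_b le_min !ler_nat leqnn card_items.
rewrite won_other // big_set0 le_min valuation_other // lexx.
exact: budget_ge0.
Qed.

(** Retained items of [S] become no cheaper, as beating [b] takes a bid of at least 1. Each lost
    item of [S] costs at least 1 in value and saves at most 1; items outside [S] add no value. *)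
Lemma deviation_a y : nonneg y ->
  (utility A G (replace bid a y) a <= utility A G bid a)%E.
Proof.
move=> y0; have bid0 := bid_ge0.
have dev0 := nonneg_replace _ a _ bid0 y0.
rewrite (utility_within_budget _ _ _ _ bid0 (tied_conservative a)).
apply: utility_le; set T := won _ _ (replace _ _ _) _.
rewrite !valuation_a won_a first_item_value_self natrD.
have -> : total_payment A G bid a = \sum_(j in S) pay j by [].
have payS := sum_pay_le S.
have payT := total_payment_ge0 A G _ a dev0.
(* Without items of [S] the deviation yields at most 0, whereas the equilibrium utility is at least
   [m.-1]. *)
rewrite {1}/first_item_value; case: ifP => _.
  by have := ler0n R m.-1; lra.
have payTS : \sum_(j in S :&: T) pay j <= total_payment A G (replace bid a y) a.
  rewrite /total_payment -/T [X in _ <= X](big_setID S) /=.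
  rewrite [T :&: S]finset.setIC.
  rewrite -[X in X <= _]addr0.
  apply: lerD; last first.
    by apply: sumr_ge0 => j _; exact: (payment_ge0 A G _ j dev0).
  apply: ler_sum => j; rewrite inE => /andP[_ jT].
  have y1 : 1 <= y j.
    have := won_max A G _ _ _ dev0 jT b.
    by rewrite /replace eqxx [b == a]eq_sym (negbTE ab) /= tied_bid_b.
  (* Viewing the equilibrium column as a replacement of the bid of [a] by itself lets monotonicity
     compare the bids 1 and [y j]. *)
  rewrite /pay replace_column -{1}(replace_id _ _ (fun k => bid k j) a).
  rewrite tied_bid_a.
  apply: payment_nondecreasing => //; exact: budget_ge0.
have payST := sum_pay_le (S :\: T).
rewrite (big_setID T) /= -[X in _ <= _ + X%:R - _](cardsID T S) !natrD.
rewrite [T :&: S]finset.setIC; lra.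
Qed.

(* Conservativeness forces the bids on the items won to be exactly 1, i.e. those
   of the equilibrium, so that the deviation can only lose items. *)
Lemma deviation_b y : nonneg y -> conservative A G (replace bid b y) b ->
  (utility A G (replace bid b y) b <= utility A G bid b)%E.
Proof.
move=> y0; have bid0 := bid_ge0.
have dev0 := nonneg_replace _ b _ bid0 y0.
rewrite (utility_within_budget _ _ _ _ bid0 (tied_conservative b)).
rewrite /conservative le_min valuation_b => /andP[+ _].
rewrite -sumr_const; set T := won _ _ (replace _ _ _) _ => sum_le.
have y_ge1 j : j \in T -> 1 <= y j.
  move=> jT; have := won_max A G _ _ _ dev0 jT a.
  by rewrite /replace eqxx (negbTE ab) /= tied_bid_a.
have y1 j : j \in T -> y j = bid b j.
  move=> jT; rewrite tied_bid_b; apply/le_anti; rewrite y_ge1 // andbT.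
  (* The other won items already absorb at least 1 each of the total [#|T|], leaving at most 1 for
     [y j]. *)
  move: sum_le; rewrite (bigD1 j) //= [X in _ <= X](bigD1 j) //=.
  rewrite {1}/replace eqxx.
  have : \sum_(k in T | k != j) 1 <= \sum_(k in T | k != j) replace bid b y b k.
    by apply: ler_sum => k /andP[/y_ge1 + _]; rewrite /replace eqxx.
  lra.
have same_column j : j \in T ->
    (fun k => replace bid b y k j) = (fun k => bid k j).
  by move=> jT; rewrite replace_column y1 // replace_id.
apply: utility_le; rewrite -/T !valuation_b.
have -> : total_payment A G (replace bid b y) b = \sum_(j in T) pay j.
  by apply: eq_bigr => j jT; rewrite same_column.
set W := won A G bid b.
have TW : T \subset W.
  by apply/fintype.subsetP => j jT; have := jT; rewrite !mem_won same_column.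
have -> : total_payment A G bid b = \sum_(j in W) pay j by [].
have payWT := sum_pay_le (W :\: T).
rewrite [X in _ <= _ - X](big_setID T) /=.
rewrite -[X in _ <= X%:R - _](cardsID T W) natrD.
by rewrite (finset.setIidPr TW); lra.
Qed.

Lemma tied_nash : pure_nash A G bid.
Proof.
have bid0 := bid_ge0.
split=> // [|i y y0 cons]; first exact: tied_conservative.
have [ia|ia] := eqVneq i a; first by subst i; apply: deviation_a.
have [ib|ib] := eqVneq i b; first by subst i; apply: deviation_b.
rewrite (utility_within_budget _ _ _ _ bid0 (tied_conservative i)).
apply: utility_le; rewrite !valuation_other // lerB //.
rewrite {1}/total_payment won_other // big_set0.
exact/total_payment_ge0/nonneg_replace.
Qed.

(** * Liquid welfare and the resulting ratio *)

Lemma liquid_welfare_tied_game X :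
  liquid_welfare G X =
    (minn (first_item_value S (bundle X a)) m + #|bundle X b|)%:R.
Proof.
have ba : b != a by rewrite eq_sym.
rewrite /liquid_welfare (bigD1 a isT) (bigD1 b ba) big1 => [|i].
  rewrite /= addr0 /tied_budget a2 b2 /tied_valuation !eqxx (negbTE ba) natrD.
  have bm : (#|bundle X b| <= m)%N by apply: card_items.
  by rewrite -!natr_min !minEnat (minn_idPl bm).
move=> /andP[/andP[_ ia] ib]; rewrite valuation_other // min_l //.
exact: budget_ge0.
Qed.

Lemma tied_equilibrium_welfare :
  liquid_welfare G (allocation A G bid) = (m + (m - #|S|))%:R.
Proof.
rewrite liquid_welfare_tied_game -/(won A G bid a) -/(won A G bid b).
(* As [S] is nonempty, the value of [a] reaches her budget [m] and is capped there. *)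
rewrite won_a won_b first_item_value_self (minn_idPr _); last by lia.
by congr (_ + _)%:R; have := cardsC S; rewrite card_ord; lia.
Qed.

Lemma tied_better_allocation :
  exists X, liquid_welfare G X = (m + m.-1)%:R.
Proof.
have [j0 j0S] : exists j, j \in S by apply/set0Pn; rewrite -card_gt0.
exists [ffun j => if j == j0 then a else b].
rewrite liquid_welfare_tied_game.
have -> : bundle [ffun j => if j == j0 then a else b] a = [set j0]%SET.
  apply/setP => j; rewrite !inE ffunE.
  by have [_|_] := eqVneq j j0; rewrite ?eqxx // eq_sym (negbTE ab).
have -> : bundle [ffun j => if j == j0 then a else b] b = ~: [set j0]%SET.
  apply/setP => j; rewrite !inE ffunE.
  by have [_|_] := eqVneq j j0; rewrite ?eqxx ?(negbTE ab).
have : (0 < m)%N by apply: leq_ltn_trans (ltn_ord j0).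
have j0I : [set j0]%SET :&: S = [set j0]%SET.
  by apply/finset.setIidPl; rewrite finset.sub1set.
rewrite /first_item_value j0I -cards_eq0 cards1 /=.
have := cardsC1 j0; rewrite card_ord => -> m0.
by rewrite (minn_idPr _) //; lia.
Qed.

Lemma tied_game_bound : (m <= 2 * #|S|)%N ->
  ((4 / 3 - 2 / (3 * m%:R))%:E <= LPoA A)%E.
Proof.
move=> large; have [X optX] := tied_better_allocation.
have leS : (#|S| <= m)%N by apply: card_items.
have m0 : (0 < m)%N by exact: leq_trans leS.
apply: (@le_trans _ _ (liquid_ratio A G)); last first.
  by apply: ereal_sup_ubound; exists G.
have := liquid_ratio_ge A G _ X tied_nash.
rewrite optX tied_equilibrium_welfare !ltr0n => ratio.
apply: le_trans (ratio _ _); [|lia..].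
rewrite lee_fin.
have mR : 0 < m%:R :> R by rewrite ltr0n.
have -> : 4 / 3 - 2 / (3 * m%:R) = (4 * m%:R - 2) / (3 * m%:R) :> R.
  by field; rewrite gt_eqF.
(* Cleared of denominators, the claim is [m <= 2 * #|S|] multiplied by the nonnegative factor
   [2 * m - 1]. *)
rewrite ler_pdivrMr ?mulr_gt0 // mulrAC ler_pdivlMr; last by rewrite ltr0n; lia.
rewrite -subn1 !natrD !natrB //.
have : m%:R <= 2 * #|S|%:R :> R by rewrite -natrM ler_nat.
have : 1 <= m%:R :> R by rewrite ler1n.
nra.
Qed.

End TiedEquilibrium.

Theorem theorem8 (R : realType) (n m : nat) (A : simple_auction R n m)
    (hn : (1 < n)%N) (hm : (0 < m)%N) :
  ((4 / 3 - 2 / (3 * m%:R))%:E <= LPoA A)%E.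
Proof.
pose p0 := Ordinal (ltnW hn); pose p1 := Ordinal hn.
have : bundle (tied_allocation A) p1 = ~: bundle (tied_allocation A) p0.
  exact: (won_b A p0 p1 isT isT isT).
have := cardsC (bundle (tied_allocation A) p0); rewrite card_ord.
move=> cardC won1; rewrite -won1 in cardC.
(* The two active players win complementary sets, so one of them gets at least half of the items and
   takes the role of [a]. *)
have [large|small] := leqP m (2 * #|bundle (tied_allocation A) p0|).
  by apply: (tied_game_bound A p0 p1) => //; lia.
by apply: (tied_game_bound A p1 p0) => //; lia.
Qed.
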